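(* A connected graph $G$ satisfies $\mathrm{vp}^-(G) = 1$ if and only if $G$ is a path. The only connected graphs with $\mathrm{vp}(G) = 1$ are $K_1$ and $K_2$.
   Context: All graphs are finite, undirected and simple; the one-vertex graph counts as a path. A $u,v$-geodesic is a shortest $u,v$-path. For a vertex $x$ of $G$, a set $S \subseteq V(G)$ is an $x$-position set if for every $y \in S$ no vertex of $S \setminus \{y\}$ lies on any $x,y$-geodesic in $G$ (in particular $\{x\}$ is an $x$-position set). The $x$-position number $p_x(G)$ is the maximum cardinality of an $x$-position set of $G$. Define $\mathrm{vp}(G) = \max_{x \in V(G)} p_x(G)$ and $\mathrm{vp}^-(G) = \min_{x \in V(G)} p_x(G)$. *)

(* Defs.v *)
From mathcomp Require Import all_boot.
From mathcomp Require Import boolp.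

Set Implicit Arguments.
Unset Strict Implicit.
Unset Printing Implicit Defensive.

Record sgraph := SGraph {
  vertex :> finType;
  adj : rel vertex;
  adj_sym : symmetric adj;
  adj_irrefl : irreflexive adj
}.

Definition connected (G : sgraph) : Prop :=
  0 < #|G| /\ forall x y : G, connect (@adj G) x y.

Definition isomorphic (G H : sgraph) : Prop :=
  exists f : G -> H, bijective f /\ forall x y : G, adj (f x) (f y) = adj x y.

Definition path_rel (n : nat) : rel 'I_n :=
  fun i j => (i.+1 == j :> nat) || (j.+1 == i :> nat).

Lemma path_rel_sym n : symmetric (@path_rel n).
Proof. by move=> i j; rewrite /path_rel orbC. Qed.

Lemma path_rel_irrefl n : irreflexive (@path_rel n).
Proof. by move=> i; rewrite /path_rel orbb gtn_eqF. Qed.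

Definition path_graph (n : nat) : sgraph :=
  SGraph (@path_rel_sym n) (@path_rel_irrefl n).

Definition complete_rel (n : nat) : rel 'I_n := fun i j => i != j.

Lemma complete_rel_sym n : symmetric (@complete_rel n).
Proof. by move=> i j; rewrite /complete_rel eq_sym. Qed.

Lemma complete_rel_irrefl n : irreflexive (@complete_rel n).
Proof. by move=> i; rewrite /complete_rel eqxx. Qed.

Definition complete_graph (n : nat) : sgraph :=
  SGraph (@complete_rel_sym n) (@complete_rel_irrefl n).

Definition is_path_graph (G : sgraph) : Prop :=
  exists2 n : nat, 0 < n & isomorphic G (path_graph n).

(* As in the library's [path], a path from u is given by u and the sequence p
   of its remaining vertices, so its vertex set is u :: p and its length is
   size p. *)
Definition upath (G : sgraph) (u v : G) (p : seq G) : Prop :=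
  [/\ path (@adj G) u p, last u p = v & uniq (u :: p)].

Definition geodesic (G : sgraph) (u v : G) (p : seq G) : Prop :=
  upath u v p /\ forall q : seq G, upath u v q -> size p <= size q.

Definition position_set (G : sgraph) (x : G) (S : {set G}) : Prop :=
  forall y : G, y \in S ->
  forall p : seq G, geodesic x y p ->
  forall z : G, z \in S :\ y -> z \notin x :: p.

Definition position_number (G : sgraph) (x : G) : nat :=
  \max_(S : {set G} | `[< position_set x S >]) #|S|.

Definition vp (G : sgraph) : nat := \max_(x : G) position_number x.

(* position_number x <= #|G| always holds, so the default value #|G| does not
   affect the minimum when G has a vertex. *)
Definition vp_min (G : sgraph) : nat := \big[minn/#|G|]_(x : G) position_number x.

(* Main.v *)
Require Import Defs.
From mathcomp Require Import all_boot.
From mathcomp Require Import boolp.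
From mathcomp Require Import zify.

Set Implicit Arguments.
Unset Strict Implicit.
Unset Printing Implicit Defensive.

(** Two distinct vertices at the same distance from x form an x-position set.
    So p_x(G) = 1 forces the distance from x to be injective, and a connected
    graph with an injective distance function is a path starting at x.
    Conversely, in a path every walk from an end vertex to a vertex traverses all
    the vertices in between, so for an end vertex x any x-position set is a
    singleton.  If p_x(G) = 1 for every x, then G is a path in which no vertex
    has two neighbours, hence has at most two vertices. *)

Section Distance.
Variable G : sgraph.
Implicit Types (x y z : G) (p : seq G) (S : {set G}).

(** * Walks, distances and geodesics *)

Definition has_walk x y : pred nat := fun k =>
  [exists p : k.-tuple G, path (@adj G) x p && (last x p == y)].

(* The value is #|G| when y is not reachable from x. *)
Definition dist x y : nat := find (has_walk x y) (iota 0 #|G|).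

Lemma dist_le_walk x p : path (@adj G) x p -> dist x (last x p) <= size p.
Proof.
(* A walk short enough to be searched bounds the first hit of [find]; a longer one is covered by the
   cap [#|G|] on [find]. *)
move=> xp; case: (ltnP (size p) #|G|) => [ltpG | leGp].
  rewrite leqNgt; apply/negP => /(before_find 0).
  rewrite nth_iota // add0n => /existsP[]; exists (in_tuple p).
  by rewrite xp eqxx.
by apply: leq_trans leGp; rewrite -[leqRHS](size_iota 0) find_size.
Qed.

(** Shortening any walk gives a path with fewer than [#|G|] edges, so the search in [dist] succeeds.
    The walk it finds is shortened once more to become a path, and minimality of [dist] keeps its
    length. *)
Lemma geodesic_exists x y :
  connect (@adj G) x y -> exists2 p, geodesic x y p & size p = dist x y.
Proof.
case/connectP=> q0 xq0 ->; case: (shortenP xq0) => q xq uq _.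
have ltqG : size q < #|G|.
  by rewrite -[(size q).+1]/(size (x :: q)) -(card_uniqP uq) max_card.
have hasq : has (has_walk x (last x q)) (iota 0 #|G|).
  apply/hasP; exists (size q); first by rewrite mem_iota.
  by apply/existsP; exists (in_tuple q); rewrite /= xq eqxx.
move: (nth_find 0 hasq); rewrite -/(dist _ _).
have lt_d : dist x (last x q) < #|G| by rewrite -(size_iota 0 #|G|) -has_find.
rewrite nth_iota // add0n => /existsP[p /andP[xp /eqP lastp]].
have le_d r : upath x (last x q) r -> dist x (last x q) <= size r.
  by case=> xr <- _; apply: dist_le_walk.
have Ed := size_tuple p; case: (shortenP xp) lastp => r xr ur rp lastr.
have ler : size r <= dist x (last x q).
  by rewrite -[leqRHS]Ed uniq_leq_size //; case/andP: ur.
have Er : size r = dist x (last x q).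
  by apply/eqP; rewrite eqn_leq ler le_d.
by exists r => //; split=> // s /le_d; rewrite Er.
Qed.

Lemma geodesic_size x y p : geodesic x y p -> size p = dist x y.
Proof.
case=> [[xp lastp up] minp].
have xy : connect (@adj G) x y by apply/connectP; exists p.
have [q [uq minq] <-] := geodesic_exists xy.
by apply/eqP; rewrite eqn_leq minp //= minq.
Qed.

(** * Position sets and position numbers *)

(** Every vertex of a geodesic from [x] other than its last one is strictly closer to [x] than the
    last one. *)
Lemma position_set_pair x y z :
  dist x y = dist x z -> position_set x [set y; z].
Proof.
move=> eqd u uS p up w; rewrite in_setD1 => /andP[neqwu wS]; apply/negP => wp.
have eqwu : dist x w = dist x u.
  by case/set2P: uS => ->; case/set2P: wS => ->.
have := geodesic_size up; rewrite -eqwu; case: up => [[xp lastp _] _].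
case/splitPl: wp xp lastp => p1 [|v p2] lastw; rewrite cat_path last_cat.
  by move=> _ /= eqwu'; rewrite -eqwu' lastw eqxx in neqwu.
case/andP=> /dist_le_walk; rewrite lastw => le_d _ _.
by rewrite size_cat /=; lia.
Qed.

Lemma position_set1 x : position_set x [set x].
Proof. by move=> y /set1P-> p _ z; rewrite setDv inE. Qed.

Lemma card_position_set x S : position_set x S -> #|S| <= position_number x.
Proof. by move=> xS; apply: leq_bigmax_cond; apply/asboolP. Qed.

Lemma position_number_gt0 x : 0 < position_number x.
Proof. by have := card_position_set (@position_set1 x); rewrite cards1. Qed.

Lemma position_number_le1 x :
  (forall S y z, position_set x S -> y \in S -> z \in S -> y = z) ->
  position_number x <= 1.
Proof.
move=> inj; apply/bigmax_leqP => S /asboolP xS.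
by apply/card_le1_eqP => y z yS zS; apply: (inj S).
Qed.

Lemma position_number_le_card x : position_number x <= #|G|.
Proof. by apply/bigmax_leqP => S _; apply: max_card. Qed.

Lemma dist_inj x : position_number x <= 1 -> injective (dist x).
Proof.
move=> le1 y z /position_set_pair/card_position_set/leq_trans/(_ le1).
by rewrite cards2; case: eqP.
Qed.

Lemma vp_min_le x : vp_min G <= position_number x.
Proof.
rewrite /vp_min; elim: (index_enum G) (mem_index_enum x) => // y s IHs.
rewrite inE big_cons => /predU1P[-> | /IHs]; first exact: geq_minl.
by apply: leq_trans; apply: geq_minr.
Qed.

Lemma vp_min_gt0 : 0 < #|G| -> 0 < vp_min G.
Proof.
move=> G0; rewrite /vp_min; elim/big_ind: _ => // [m n m0 n0|x _].
  by rewrite leq_min m0.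
exact: position_number_gt0.
Qed.

Lemma vp_min_attained :
  0 < #|G| -> exists x, position_number x = vp_min G.
Proof.
case/card_gt0P=> x0 _.
have [/existsP[x /eqP] | none] :=
  boolP [exists x : G, position_number x == vp_min G]; first by exists x.
(* The iterated minimum may return its default [#|G|]; every position number then lies between
   [vp_min G] and [#|G|], so any vertex attains it. *)
have [E | [x E]] : vp_min G = #|G| \/ exists x, vp_min G = position_number x.
- rewrite /vp_min; elim/big_ind: _ => [|m n Hm Hn|x _]; first by left.
    by rewrite /minn; case: ifP.
  by right; exists x.
- exists x0; apply/eqP; rewrite eqn_leq vp_min_le E.
  by rewrite position_number_le_card.
- by exists x.
Qed.

(** * Distances along edges *)

Lemma dist_adj x y z :
  connect (@adj G) x y -> adj y z -> dist x z <= (dist x y).+1.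
Proof.
move=> /geodesic_exists[p [[xp <- _] _] <-] yz.
have := @dist_le_walk x (rcons p z).
by rewrite rcons_path last_rcons size_rcons xp yz; apply.
Qed.

(** The vertex before the last on a geodesic serves: the remaining walk bounds its distance above,
    the final edge below. *)
Lemma dist_pred x z n :
  connect (@adj G) x z -> dist x z = n.+1 ->
  exists2 y, adj y z & dist x y = n.
Proof.
move=> xz Dz; have [p [[xp lastp _] _]] := geodesic_exists xz.
rewrite Dz; case/lastP: p xp lastp => // p w.
rewrite rcons_path last_rcons size_rcons => /andP[xp yw] Ew [En].
rewrite {}Ew in yw; exists (last x p) => //.
have xy : connect (@adj G) x (last x p) by apply/connectP; exists p.
by have := dist_adj xy yw; have := dist_le_walk xp; lia.
Qed.

Lemma dist_adjacent x y : adj x y -> dist x y = 1.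
Proof.
move=> xy; have [p [[_ lastp _] _] Ed] := geodesic_exists (connect1 xy).
have : dist x y <= 1 by apply: (@dist_le_walk x [:: y]); rewrite /= xy.
rewrite -Ed; case: p {Ed} lastp => [/= Exy | z [|]] //.
by rewrite Exy adj_irrefl in xy.
Qed.

Lemma dist_lt_card x y : connect (@adj G) x y -> dist x y < #|G|.
Proof.
move=> /geodesic_exists[p [[_ _ up] _] <-].
by rewrite -[(size p).+1]/(size (x :: p)) -(card_uniqP up) max_card.
Qed.

(** Distances of adjacent vertices differ by at most 1, and by injectivity they differ. Conversely,
    the farther vertex has a neighbour one step closer to [x], which injectivity identifies with the
    nearer vertex. *)
Lemma adj_dist x y z :
  (forall u v, connect (@adj G) u v) -> injective (dist x) ->
  adj y z = (dist x z == (dist x y).+1) || (dist x y == (dist x z).+1).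
Proof.
move=> conn inj; apply/idP/idP => [yz | ].
  have := dist_adj (conn x y) yz; rewrite adj_sym in yz.
  have := dist_adj (conn x z) yz; have : dist x y != dist x z.
    by rewrite (inj_eq inj); apply: contraTneq yz => ->; rewrite adj_irrefl.
  by lia.
by case/orP=> /eqP/(dist_pred (conn _ _))[w ? /inj <-] //; rewrite adj_sym.
Qed.

(** The distance from [x] is itself the isomorphism: it is injective into ['I_#|G|], hence bijective
    by cardinality. *)
Lemma connected_path_graph x :
  connected G -> position_number x <= 1 -> is_path_graph G.
Proof.
move=> [G0 conn] /dist_inj inj; exists #|G| => //.
pose f y : 'I_#|G| := Ordinal (dist_lt_card (conn x y)).
have injf : injective f by move=> y z [] /inj.
exists f; split; first by apply: inj_card_bij; rewrite ?card_ord.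
move=> y z; rewrite (adj_dist y z conn inj) /= /path_rel /=.
by rewrite eq_sym (eq_sym (dist x z).+1).
Qed.

(** * Position numbers at most 1 *)

(** A discrete intermediate value property: [g] rises by at most 1 along each edge, so it skips no
    value. *)
Lemma path_intermediate (g : G -> nat) x p k :
  (forall y z, adj y z -> g z <= (g y).+1) ->
  path (@adj G) x p -> g x <= k <= g (last x p) ->
  exists2 z, z \in x :: p & g z = k.
Proof.
move=> gS; elim: p x => [|y p IHp] x /=.
  by move=> _ lekk; exists x; rewrite ?inE //; apply/eqP; rewrite eqn_leq.
case/andP=> xy yp /andP[]; rewrite leq_eqVlt => /predU1P[<- _ | ltk lek].
  by exists x; rewrite ?inE ?eqxx.
case: (IHp y yp) => [|z zp gz]; first by rewrite lek (leq_trans (gS _ _ xy)).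
by exists z; rewrite // inE zp orbT.
Qed.

(** The vertex [x] lies on every geodesic that starts at [x]. *)
Lemma position_set_center x S y :
  connect (@adj G) x y -> position_set x S -> x \in S -> y \in S -> y = x.
Proof.
move=> /geodesic_exists[p xpy _] xS xinS yS; apply/eqP/negPn/negP => neq.
by have := xS y yS p xpy x; rewrite !inE eq_sym neq xinS eqxx; move/(_ isT).
Qed.

Lemma position_number_card2 x :
  connected G -> #|G| <= 2 -> position_number x <= 1.
Proof.
move=> [_ conn] G2; apply: position_number_le1 => S y z xS yS zS.
apply/eqP/negPn/negP => neq.
(* Two distinct vertices exhaust the graph, so one of them is [x]. *)
have : x \in [set y; z].
  rewrite (_ : [set y; z] = setT) ?inE //.
  by apply/eqP; rewrite eqEcard subsetT cardsT cards2 neq.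
case/set2P=> Ex; rewrite {}Ex in xS.
  by rewrite (position_set_center _ xS yS zS) ?eqxx in neq.
by rewrite (position_set_center _ xS zS yS) ?eqxx in neq.
Qed.

Lemma vp_eq1 :
  0 < #|G| -> (vp G = 1 <-> forall x, position_number x <= 1).
Proof.
move=> /card_gt0P[x _]; split=> [vp1 y | le1].
  by rewrite -vp1; apply: leq_bigmax.
apply/eqP; rewrite eqn_leq; apply/andP; split; first by apply/bigmax_leqP.
by apply: leq_trans (position_number_gt0 x) _; apply: leq_bigmax.
Qed.

Lemma vp_min_eq1 :
  0 < #|G| -> (vp_min G = 1 <-> exists x, position_number x <= 1).
Proof.
move=> G0; split=> [vp1 | [x le1]].
  by have [x Ex] := vp_min_attained G0; exists x; rewrite Ex vp1.
by apply/eqP; rewrite eqn_leq vp_min_gt0 // (leq_trans (vp_min_le x)).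
Qed.

Lemma path_graph_position_number :
  connected G -> is_path_graph G -> exists x, position_number x <= 1.
Proof.
move=> [_ conn] [n n0 [f [[g fK gK] adjf]]].
(* The end vertex numbered 0. *)
exists (g (Ordinal n0)); set x := g _.
have fS y z : adj y z -> f z <= (f y).+1.
  by rewrite -adjf /= /path_rel; lia.
have noS S y z : position_set x S -> y \in S -> z \in S -> f y < f z -> False.
  move=> xS yS zS ltyz.
  have [p xpz _] := geodesic_exists (conn x z).
  have [[xp lastp _] _] := xpz.
  (* The geodesic climbs from number 0 to [f z], so it meets the vertex numbered [f y], which is
     [y]. *)
  have [|w wp /val_inj/(can_inj fK) Ew] := path_intermediate (k := f y) fS xp.
    by rewrite lastp gK /= ltnW.
  have := xS z zS p xpz y; rewrite -Ew wp !inE Ew yS andbT.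
  by case: eqP => [Eyz | _ /(_ isT)] //; rewrite Eyz ltnn in ltyz.
apply: position_number_le1 => S y z xS yS zS.
apply/(can_inj fK)/val_inj.
by have [/(noS _ _ _ xS yS zS) | /(noS _ _ _ xS zS yS) |] := ltngtP (f y) (f z).
Qed.

(** * Small complete graphs and paths *)

Lemma complete_graph_connected n :
  0 < n -> isomorphic G (complete_graph n) -> connected G /\ #|G| = n.
Proof.
move=> n0 [f [bijf adjf]]; have cardG : #|G| = n.
  by rewrite (bij_eq_card bijf) card_ord.
split=> //; split=> [|x y]; first by rewrite cardG.
have [-> | neq] := eqVneq x y; first exact: connect0.
by rewrite connect1 // -adjf /= /complete_rel (bij_eq bijf).
Qed.

(** From three vertices on, vertex 1 of the path has the two neighbours 0 and 2; the paths on one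
    and two vertices are complete. *)
Lemma path_graph_small n :
  0 < n -> (forall x y z : G, adj x y -> adj x z -> y = z) ->
  isomorphic G (path_graph n) ->
  isomorphic G (complete_graph 1) \/ isomorphic G (complete_graph 2).
Proof.
case: n => [//|[|[|n]]] _ adj1 [f [bijf adjf]].
- by left; exists f; split=> // x y; rewrite -adjf /= /complete_rel !ord1.
- right; exists f; split=> // x y; rewrite -adjf /= /complete_rel /path_rel.
  by case: (f x) (f y) => [[|[|]]] // ? [[|[|]]].
- case: bijf adjf => g fK gK adjf.
  have ladj i j : path_rel i j -> adj (g i) (g j) by rewrite -adjf !gK.
  pose i k (lt : k < n.+3) := Ordinal lt.
  have g10 := ladj (i 1 isT) (i 0 isT) isT.
  have g12 := ladj (i 1 isT) (i 2 isT) isT.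
  by have /(can_inj gK) := adj1 _ _ _ g10 g12.
Qed.

End Distance.

Theorem corollary2p7 :
  (forall G : sgraph, connected G -> (vp_min G = 1 <-> is_path_graph G)) /\
  (forall G : sgraph,
     (connected G /\ vp G = 1) <->
     (isomorphic G (complete_graph 1) \/ isomorphic G (complete_graph 2))).
Proof.
split=> [G connG | G].
  have [G0 _] := connG; rewrite (vp_min_eq1 G0).
  split=> [[x] |]; first exact: connected_path_graph.
  exact: path_graph_position_number.
split=> [[connG] | isoG].
  have [G0 _] := connG; have [x _] := card_gt0P G0.
  rewrite (vp_eq1 G0) => le1.
  have [n n0] := connected_path_graph connG (le1 x); apply: path_graph_small => //.
  (* Two neighbours of [u] are both at distance 1 from [u], hence equal. *)
  move=> u v w uv uw; apply: (dist_inj (le1 u)).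
  by rewrite !dist_adjacent.
have [connG G2] : connected G /\ #|G| <= 2.
  by case: isoG => /complete_graph_connected[] // ? ->.
have [G0 _] := connG; split=> //; apply/(vp_eq1 G0) => x.
exact: position_number_card2.
Qed.
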